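(* Let $\varepsilon \ge 0$ and $\delta \in [0,1]$, let $n \ge 1$ be an integer, let $\mathcal{D}$ be a probability distribution on a data space $\mathcal{Z}$, and let $\mathcal{M}$ be a randomized training algorithm mapping datasets in $\mathcal{Z}^n$ to models, satisfying $(\varepsilon,\delta)$-differential privacy. Then for every (possibly randomized) membership inference adversary $\mathcal{A}$, the membership inference advantage of $\mathcal{A}$ against $\mathcal{M}$ (with sample size $n$ and distribution $\mathcal{D}$) satisfies $$\mathrm{Adv}(\mathcal{A},\mathcal{M},n,\mathcal{D}) \;\le\; 1 - e^{-\varepsilon} + \delta\, e^{-\varepsilon}.$$
   Context: Differential privacy: a randomized algorithm $\mathcal{M}:\mathcal{Z}^n\to\mathcal{Y}$ is $(\varepsilon,\delta)$-differentially private if for all datasets $S,S'\in\mathcal{Z}^n$ that differ in exactly one record (one entry replaced by another) and all measurable $E\subseteq\mathcal{Y}$, $\Pr[\mathcal{M}(S)\in E]\le e^{\varepsilon}\Pr[\mathcal{M}(S')\in E]+\delta$. Membership inference experiment: sample $S=(z_1,\dots,z_n)\sim\mathcal{D}^n$ (i.i.d.) and train $Y=\mathcal{M}(S)$. Choose a bit $b\in\{0,1\}$ uniformly, independently of $(S,Y)$. If $b=0$ (member case), let $z=z_i$ for an index $i$ uniform in $\{1,\dots,n\}$, independent of everything else; if $b=1$ (non-member case), let $z\sim\mathcal{D}$ be a fresh draw, independent of everything else. The adversary $\mathcal{A}$ receives $(z,Y)$ (and knows $n$ and $\mathcal{D}$) and, using only its own independent randomness, outputs a guess, either ''member'' or ''non-member''.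 The true positive rate is $\mathrm{TPR}=\Pr[\mathcal{A}\text{ outputs ''member''}\mid b=0]$, and the false positive rate is $\mathrm{FPR}=\Pr[\mathcal{A}\text{ outputs ''member''}\mid b=1]$. The membership inference advantage is $\mathrm{Adv}(\mathcal{A},\mathcal{M},n,\mathcal{D})=\mathrm{TPR}-\mathrm{FPR}$. Measurability of all maps involved is assumed. *)

(* Defs.v *)
(* Conventions.
   - Randomized maps (the training algorithm, the adversary) are Markov kernels
     [R.-pker X ~> Y]: [k x] is the law of the output on input [x].
   - A dataset of size n is an [n.-tuple Z] with the product sigma-algebra.
   - The challenge bit b is a boolean: b = 0 (member) is [false] and b = 1
     (non-member) is [true].
   - The adversary's guess is a boolean: [true] is the answer "member".      *)
From HB Require Import structures.
From mathcomp Require Import all_boot all_order all_algebra.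
From mathcomp Require Import all_classical all_reals all_analysis.
From mathcomp Require Import measurable_realfun.

Set Implicit Arguments.
Unset Strict Implicit.
Unset Printing Implicit Defensive.

Import Order.TTheory GRing.Theory Num.Theory.
Import numFieldNormedType.Exports.

Local Open Scope classical_set_scope.
Local Open Scope ring_scope.
Local Open Scope ereal_scope.

HB.instance Definition _ n := isPointed.Build 'I_n.+1 ord0.
HB.instance Definition _ n := @isMeasurable.Build default_measure_display
  'I_n.+1 discrete_measurable discrete_measurable0
  discrete_measurableC discrete_measurableU.

Section uniform_ord.
Context {R : realType} (n : nat).

Definition uniform_ord : set 'I_n.+1 -> \bar R :=
  mscale ((n.+1%:R^-1)%:nng)%R (msum (fun k => \d_(inord k : 'I_n.+1)) n.+1).

HB.instance Definition _ := Measure.on uniform_ord.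

Lemma uniform_ordE A :
  uniform_ord A = (n.+1%:R^-1)%:E * \sum_(i < n.+1) \d_i A.
Proof.
rewrite /uniform_ord /mscale /= /msum.
by congr (_ * _); apply: eq_bigr => i _; rewrite inord_val.
Qed.

Let uniform_ord_setT : uniform_ord [set: 'I_n.+1] = 1.
Proof.
rewrite uniform_ordE; under eq_bigr do rewrite diracT.
by rewrite sumEFin -EFinM sumr_const card_ord mulVf// pnatr_eq0.
Qed.

HB.instance Definition _ := Measure_isProbability.Build _ _ _
  uniform_ord uniform_ord_setT.

End uniform_ord.

Section iid.
Context {d} {T : measurableType d} {R : realType}.

Definition cons_pair n (x : T * n.-tuple T) : n.+1.-tuple T :=
  [the n.+1.-tuple T of x.1 :: x.2].

Let measurable_cons_pair n :
  measurable_fun [set: T * n.-tuple T] (@cons_pair n).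
Proof. exact: measurable_cons. Qed.

HB.instance Definition _ n := isMeasurableFun.Build _ _ _ _ (@cons_pair n)
  (@measurable_cons_pair n).

(* The product measure P^n; see [iid_prob_box]. *)
Fixpoint iid_prob (P : probability T R) n : probability (n.-tuple T) R :=
  match n return probability (n.-tuple T) R with
  | 0 => \d_[tuple]
  | m.+1 => distribution (P \x iid_prob P m) (@cons_pair m)
  end.

Lemma iid_prob_box (P : probability T R) n (A : 'I_n -> set T) :
  (forall i, measurable (A i)) ->
  iid_prob P n [set s | forall i, A i (tnth s i)] = \prod_(i < n) P (A i).
Proof.
elim: n A => [|n IH] A mA.
  by rewrite big_ord0 /= diracE mem_set// => -[].
rewrite big_ord_recl -IH; last by move=> i; exact: mA.
rewrite -product_measure1E//; last first.
  rewrite (_ : [set s | _] = \bigcap_(i in [set: 'I_n])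
      ((fun s : n.-tuple T => tnth s i) @^-1` A (lift ord0 i))); last first.
    by apply/seteqP; split=> [s /= h i _|s /= h i]; [exact: h|exact: (h i Logic.I)].
  apply: fin_bigcap_measurable => // i _.
  by rewrite -[X in measurable X]setTI; exact: measurable_tnth.
rewrite /= /distribution /pushforward; congr (_ _).
apply/seteqP; split => [[x s]/= h|[x s]/= [h0 h] i].
  split; first exact: (h ord0).
  by move=> i; have := h (lift ord0 i); rewrite /cons_pair/= tnthS.
have [j ->|->] := unliftP ord0 i; last exact: h0.
by rewrite /cons_pair/= tnthS; exact: h.
Qed.

End iid.

Section kernel_comp_fun.
Context {d1 d2 d3} {X : measurableType d1} {Y : measurableType d2}
  {Z : measurableType d3} {R : realType}.
Variables (k : R.-pker Y ~> Z) (f : {mfun X >-> Y}).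

Definition kernel_comp_fun (x : X) : {measure set Z -> \bar R} := k (f x).

Let measurable_kernel_comp_fun U :
  measurable U -> measurable_fun [set: X] (kernel_comp_fun ^~ U).
Proof.
move=> mU; apply: (measurableT_comp (measurable_kernel k U mU)) => //.
Qed.

HB.instance Definition _ := isKernel.Build _ _ _ _ _
  kernel_comp_fun measurable_kernel_comp_fun.

Let kernel_comp_funT x : kernel_comp_fun x [set: Z] = 1.
Proof. exact: prob_kernel. Qed.

HB.instance Definition _ := Kernel_isProbability.Build _ _ _ _ _
  kernel_comp_fun kernel_comp_funT.

End kernel_comp_fun.

(* The law of (x, y) when x ~ P and then y ~ k x. *)
Section joint.
Context {d1 d2} {X : measurableType d1} {Y : measurableType d2} {R : realType}.
Variables (P : probability X R) (k : R.-pker X ~> Y).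

Definition joint (A : set (X * Y)) : \bar R := \int[P]_x k x (xsection A x).

Let joint0 : joint set0 = 0.
Proof. by rewrite /joint integral0_eq// => x _; rewrite xsection0. Qed.

Let joint_ge0 A : 0 <= joint A.
Proof. exact: integral_ge0. Qed.

Let measurable_joint A : measurable A ->
  measurable_fun [set: X] (fun x => k x (xsection A x)).
Proof.
move=> mA; have [r hr] := measure_uub k.
by apply: measurable_fun_xsection_finite_kernel; rewrite ?inE.
Qed.

Let joint_sigma_additive : semi_sigma_additive joint.
Proof.
move=> F mF tF mUF.
rewrite [X in _ --> X](_ : _ = \sum_(n <oo) joint (F n)).
  by apply/cvg_closeP; split; [exact: is_cvg_nneseries|rewrite closeE].
rewrite -integral_nneseries//; last by move=> n; exact: measurable_joint.
apply: eq_integral => x _; apply/esym/cvg_lim => //=; rewrite xsection_bigcup.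
apply: (measure_sigma_additive _ (trivIset_xsection tF)) => ?.
exact: measurable_xsection.
Qed.

HB.instance Definition _ := isMeasure.Build _ _ _ joint
  joint0 joint_ge0 joint_sigma_additive.

Let joint_setT : joint [set: X * Y] = 1.
Proof.
rewrite /joint (eq_integral (cst 1)); last first.
  move=> x _ /=; rewrite (_ : xsection _ _ = setT) ?prob_kernel//.
  by apply/seteqP; split=> // y _; rewrite /xsection/= inE.
by rewrite integral_cst// mul1e; exact: probability_setT.
Qed.

HB.instance Definition _ := Measure_isProbability.Build _ _ _ joint joint_setT.

End joint.

Definition cond_prob {d} {T : measurableType d} {R : realType}
    (P : probability T R) (A B : set T) : R :=
  (fine (P (A `&` B)) / fine (P B))%R.

Definition neighbors {T : Type} {n : nat} (S S' : n.-tuple T) : Prop :=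
  exists i : 'I_n, tnth S i <> tnth S' i /\
    forall j : 'I_n, j != i -> tnth S j = tnth S' j.

Definition differentially_private {dZ dY} {Z : measurableType dZ}
    {Y : measurableType dY} {R : realType} {n : nat} (eps delta : R)
    (M : R.-pker (n.-tuple Z) ~> Y) : Prop :=
  forall S S' : n.-tuple Z, neighbors S S' ->
  forall E : set Y, measurable E ->
    M S E <= (expR eps)%:E * M S' E + delta%:E.

Section membership_inference.
Context {dZ dY} {Z : measurableType dZ} {Y : measurableType dY} {R : realType}
  {n : nat}.

(* ((S, Y), (b, (i, z'))): dataset, trained model, challenge bit, index of the
   record shown in the member case, fresh record shown in the non-member case. *)
Definition mi_setup := ((n.+1.-tuple Z * Y) * (bool * ('I_n.+1 * Z)))%type.

Definition setup_data (w : mi_setup) : n.+1.-tuple Z := w.1.1.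
Definition setup_model (w : mi_setup) : Y := w.1.2.
Definition setup_bit (w : mi_setup) : bool := w.2.1.
Definition setup_index (w : mi_setup) : 'I_n.+1 := w.2.2.1.
Definition setup_fresh (w : mi_setup) : Z := w.2.2.2.

Definition setup_challenge (w : mi_setup) : Z :=
  if setup_bit w then setup_fresh w else tnth (setup_data w) (setup_index w).

Definition setup_view (w : mi_setup) : Z * Y :=
  (setup_challenge w, setup_model w).

Let measurable_setup_view : measurable_fun [set: mi_setup] setup_view.
Proof.
apply/measurable_fun_pairP; split; last first.
  exact: (measurableT_comp measurable_snd measurable_fst).
rewrite (_ : _ \o _ = setup_challenge)//.
apply: measurable_fun_ifT.
- exact: (measurableT_comp measurable_fst measurable_snd).
- apply: (measurableT_comp measurable_snd).
  exact: (measurableT_comp measurable_snd measurable_snd).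
- move=> _ B mB; rewrite setTI.
  rewrite (_ : _ @^-1` B = \bigcup_(i in [set: 'I_n.+1])
      (setup_index @^-1` [set i] `&`
       (fun w : mi_setup => tnth (setup_data w) i) @^-1` B)); last first.
    apply/seteqP; split=> [w Bw|w [i _ [/= <-]]//].
    by exists (setup_index w).
  apply: fin_bigcup_measurable => // i _; apply: measurableI.
    rewrite -[X in measurable X]setTI.
    have mi : measurable_fun [set: mi_setup] setup_index.
      apply: (measurableT_comp measurable_fst).
      exact: (measurableT_comp measurable_snd measurable_snd).
    exact: mi.
  rewrite -[X in measurable X]setTI.
  have mS : measurable_fun [set: mi_setup] (fun w => tnth (setup_data w) i).
    apply: (measurableT_comp (measurable_tnth i)).
    exact: (measurableT_comp measurable_fst measurable_fst).
  exact: mS.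
Qed.

HB.instance Definition _ := isMeasurableFun.Build _ _ _ _
  setup_view measurable_setup_view.

Variables (D : probability Z R) (M : R.-pker (n.+1.-tuple Z) ~> Y)
  (A : R.-pker (Z * Y) ~> bool).

Definition setup_prob : probability mi_setup R :=
  joint (iid_prob D n.+1) M
  \x (bernoulli_prob (2^-1 : R)%R \x (@uniform_ord R n \x D)).

(* The joint law of the setup and of the adversary's guess; the guess depends
   on the setup only through the challenge record and the model. *)
Definition mi_experiment : probability (mi_setup * bool)%type R :=
  joint setup_prob (kernel_comp_fun A setup_view).

Definition guess_member : set (mi_setup * bool) := [set w | w.2 = true].
Definition bit_is (b : bool) : set (mi_setup * bool) :=
  [set w | setup_bit w.1 = b].

Definition mi_tpr : R := cond_prob mi_experiment guess_member (bit_is false).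
Definition mi_fpr : R := cond_prob mi_experiment guess_member (bit_is true).
Definition mi_advantage : R := (mi_tpr - mi_fpr)%R.

End membership_inference.

(* Main.v *)
(** The differential privacy bound passes from events to [0,1]-valued test
    functions by the tail formula for expectations.  Let [g z s] be the average,
    over the models trained on [s], of the probability that the adversary
    answers "member" on [z].  Then TPR is the mean over [i] of E[g (s_i) s], and
    FPR is E[g z s] with [z] independent of [s].  Replacing the [i]-th record of
    [s] by [z] leaves the law of [s] unchanged and turns [g (s_i) s] into [g z] at
    a neighbor of [s], so TPR <= e^eps FPR + delta; conclude with TPR <= 1. *)
Require Import Defs.
From HB Require Import structures.
From mathcomp Require Import all_boot all_order all_algebra.
From mathcomp Require Import all_classical all_reals all_analysis.
From mathcomp Require Import measurable_realfun.
From mathcomp Require Import lra.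

Set Implicit Arguments.
Unset Strict Implicit.
Unset Printing Implicit Defensive.

Import Order.TTheory GRing.Theory Num.Theory.
Import numFieldNormedType.Exports.

Local Open Scope classical_set_scope.
Local Open Scope ring_scope.

(** * Integration against the joint law of an input and a kernel output *)

Section integral_joint.
Local Open Scope ereal_scope.
Context {d1 d2} {X : measurableType d1} {Y : measurableType d2} {R : realType}.
Variables (P : probability X R) (k : R.-pker X ~> Y).

(* The dummy [unit] argument fits the shape required by [kcomp]. *)
Definition kpair (u : unit * X) : {measure set (X * Y) -> \bar R}.
Proof.
refine (pushforward (k u.2) (pair u.2) : {measure set _ -> \bar R}).
exact: pair1_measurable.
Defined.

Let measurable_kpair U : measurable U ->
  measurable_fun [set: unit * X] (kpair ^~ U).
Proof.
move=> mU; have [r hr] := measure_uub k.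
have mk : measurable_fun [set: X] (fun x => k x (xsection U x)).
  by apply: measurable_fun_xsection_finite_kernel; rewrite ?inE.
rewrite (_ : (fun _ => _) = (fun x => k x (xsection U x)) \o snd).
  exact: measurableT_comp mk measurable_snd.
by apply/funext => -[t x]; rewrite /= /kpair /= /pushforward xsectionE.
Qed.

HB.instance Definition _ := isKernel.Build _ _ _ _ _ kpair measurable_kpair.

Let kpairT x : kpair x [set: X * Y] = 1.
Proof. by rewrite /kpair/= /pushforward preimage_setT prob_kernel. Qed.

HB.instance Definition _ := Kernel_isProbability.Build _ _ _ _ _ kpair kpairT.

(** [joint P k] is the composition of the constant kernel [P] with [kpair], so the integral formula
    for composed kernels applies. *)
Lemma integral_joint (f : X * Y -> \bar R) : (forall w, 0 <= f w) ->
  measurable_fun setT f ->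
  \int[joint P k]_w f w = \int[P]_x \int[k x]_y f (x, y).
Proof.
move=> f0 mf.
have mP : measurable_fun [set: unit] (cst (P : pprobability X R)).
  exact: measurable_cst.
transitivity (\int[kcomp (kprobability mP) kpair tt]_w f w).
  apply: eq_measure_integral => U mU _.
  by apply: eq_integral => x _; rewrite /kpair/= /pushforward xsectionE.
rewrite integral_kcomp//; apply: eq_integral => x _.
by rewrite /kpair /= ge0_integral_pushforward.
Qed.

End integral_joint.

(** * From privacy on events to privacy on test functions *)

Section integral_dp.
Local Open Scope ereal_scope.
Context {d} {Y : measurableType d} {R : realType}.

(** By the tail formula each expectation is the integral over r >= 0 of the probability of {f > r};
    the hypothesis is applied to each of these events. *)
Lemma integral_le_measure (P Q : probability Y R) (c e : R) (f : Y -> R) :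
  (0 <= c)%R -> (0 <= e)%R ->
  (forall E, measurable E -> P E <= c%:E * Q E + e%:E) ->
  measurable_fun setT f -> (forall y, 0 <= f y <= 1)%R ->
  \int[P]_y (f y)%:E <= c%:E * (\int[Q]_y (f y)%:E) + e%:E.
Proof.
move=> c0 e0 PQ mf f01.
have f0 y : (0 <= f y)%R by case/andP: (f01 y).
pose mfm := isMeasurableFun.Build _ _ _ _ _ mf.
pose X : {mfun Y >-> R} := HB.pack f mfm.
(* Since [f <= 1], the constant [e] is only charged on the interval [0, 1]. *)
have ccdf1 (P' : probability Y R) r : (1 <= r)%R ->
    ccdf (X : {RV P' >-> R}) r = 0.
  move=> r1; rewrite /ccdf /distribution /pushforward/=.
  rewrite (_ : _ @^-1` _ = set0) ?measure0//.
  apply/seteqP; split=> // y /=; rewrite in_itv/= andbT => /lt_geF.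
  by rewrite (le_trans _ r1)//; case/andP: (f01 y).
have EP := @ge0_expectation_ccdf _ _ R P X f0.
have EQ := @ge0_expectation_ccdf _ _ R Q X f0.
rewrite unlock /= in EP; rewrite unlock /= in EQ.
rewrite EP EQ.
set m := lebesgue_measure.
have mQ : measurable_fun (`[0%R, +oo[%classic : set R) (ccdf (X : {RV Q >-> R})).
  by apply: measurable_funTS; exact: ccdf_measurable.
have mP : measurable_fun (`[0%R, +oo[%classic : set R) (ccdf (X : {RV P >-> R})).
  by apply: measurable_funTS; exact: ccdf_measurable.
(* As [0, 1] has length 1, [e] becomes an integral over r, and the claim reduces to a pointwise
   comparison of integrands. *)
have -> : e%:E = \int[m]_(r in `[0%R, +oo[) (e%:E * (\1_`[0%R, 1%R] r)%:E).
  rewrite ge0_integralZl ?lee_fin//; last first.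
    by apply: measurable_funTS; apply/measurable_EFinP; exact: measurable_indic.
  rewrite integral_indic// setIidl; last first.
    by move=> r /=; rewrite !in_itv/= andbT => /andP[].
  rewrite [X in _ * X](_ : _ = @lebesgue_measure R `[0%R, 1%R]%classic)//.
  by rewrite lebesgue_measure_itv/= lte_fin ltr01 sube0 mule1.
rewrite -ge0_integralZl//.
rewrite -ge0_integralD//; first last.
- by apply: measurable_funeM; apply: measurable_funTS;
    apply/measurable_EFinP; exact: measurable_indic.
- by move=> r _; rewrite mule_ge0 ?lee_fin.
- by apply: measurable_funeM.
- by move=> r _; rewrite mule_ge0 ?lee_fin.
apply: ge0_le_integral => //.
- apply: emeasurable_funD; first exact: measurable_funeM.
  by apply: measurable_funeM; apply: measurable_funTS;
    apply/measurable_EFinP; exact: measurable_indic.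
- move=> r /=; rewrite in_itv/= andbT => r0.
  have [r1|r1] := leP r 1%R.
    rewrite indicE mem_set ?mule1/= ?in_itv/= ?r0//.
    apply: PQ; rewrite -[X in measurable X]setTI.
    exact: (mf measurableT _ (measurable_itv _)).
  by rewrite ccdf1 ?(ltW r1)// adde_ge0// mule_ge0 ?lee_fin.
Qed.

End integral_dp.

(** * Replacing one record of an i.i.d. sample by a fresh draw *)

Section resample.
Local Open Scope ereal_scope.
Context {d} {Z : measurableType d} {R : realType}.

Definition set_tnth n (s : n.-tuple Z) (i : 'I_n) (z : Z) : n.-tuple Z :=
  [tuple if j == i then z else tnth s j | j < n].

Lemma tnth_set_tnth n (s : n.-tuple Z) i z j :
  tnth (set_tnth s i z) j = if j == i then z else tnth s j.
Proof. by rewrite tnth_mktuple. Qed.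

(** [neighbors] demands two distinct records, so overwriting a record by itself is a separate
    case. *)
Lemma neighbors_set_tnth n (s : n.-tuple Z) i z :
  set_tnth s i z = s \/ neighbors (set_tnth s i z) s.
Proof.
have [zi|zi] := pselect (z = tnth s i); [left|right].
  by apply: eq_from_tnth => j; rewrite tnth_set_tnth; case: eqVneq => [->|].
exists i; rewrite tnth_set_tnth eqxx; split=> // j ji.
by rewrite tnth_set_tnth (negbTE ji).
Qed.

Lemma measurable_set_tnth n (i : 'I_n) :
  measurable_fun setT (fun x : Z * n.-tuple Z => set_tnth x.2 i x.1).
Proof.
apply/measurable_fun_tnthP => j.
rewrite (_ : _ \o _ = fun x : Z * n.-tuple Z =>
    if j == i then x.1 else tnth x.2 j); last first.
  by apply/funext => x /=; rewrite tnth_set_tnth.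
case: eqVneq => _; first exact: measurable_fst.
exact: (measurableT_comp (measurable_tnth j) measurable_snd).
Qed.

Lemma integral_iid_probS (P : probability Z R) n (h : n.+1.-tuple Z -> \bar R) :
  (forall s, 0 <= h s) -> measurable_fun setT h ->
  \int[iid_prob P n.+1]_s h s =
  \int[P]_x \int[iid_prob P n]_s h (cons_pair (x, s)).
Proof.
move=> h0 mh; rewrite /= ge0_integral_pushforward// preimage_setT.
rewrite fubini_tonelli1//; last by move=> ?; exact: h0.
apply: (measurableT_comp mh); exact: measurable_funP.
Qed.

(** The new record has the law of the one it overwrites and is independent of the others. The
    induction peels off the head of the tuple. *)
Lemma integral_resample (P : probability Z R) n (i : 'I_n)
    (h : n.-tuple Z -> \bar R) :
  (forall s, 0 <= h s) -> measurable_fun setT h ->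
  \int[P]_z \int[iid_prob P n]_s h (set_tnth s i z) =
  \int[iid_prob P n]_s h s.
Proof.
elim: n i h => [[]//|n IH] i h h0 mh.
have mhi (z : Z) : measurable_fun setT (fun s => h (set_tnth s i z)).
  apply: (measurableT_comp mh).
  exact: (measurableT_comp (measurable_set_tnth i) (pair1_measurable z)).
rewrite integral_iid_probS//.
under eq_integral do rewrite integral_iid_probS//.
have [j ->|->] := unliftP ord0 i.
  have set_cons x s z : set_tnth (cons_pair (x, s)) (lift ord0 j) z =
      cons_pair (x, set_tnth s j z).
    apply: eq_from_tnth => k; rewrite tnth_set_tnth.
    have [l ->|->] := unliftP ord0 k.
      rewrite /cons_pair/= !tnthS tnth_set_tnth.
      by rewrite (inj_eq (@lift_inj _ ord0)).
    by rewrite (negbTE (neq_lift _ _)).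
  under eq_integral do under eq_integral do
    under eq_integral do rewrite set_cons.
  (* [w] is the pair of the fresh record and the head: Tonelli exchanges them, and the induction
     hypothesis then applies to the tail with the head fixed. *)
  pose F (w : Z * Z) := \int[iid_prob P n]_s h (cons_pair (w.2, set_tnth s j w.1)).
  have mF : measurable_fun setT F.
    have mswap : measurable_fun setT
        (fun u : (Z * Z) * n.-tuple Z => (u.1.1, u.2)).
      apply/measurable_fun_pairP; split; last exact: measurable_snd.
      exact: (measurableT_comp measurable_fst measurable_fst).
    pose f (u : (Z * Z) * n.-tuple Z) := h (cons_pair (u.1.2, set_tnth u.2 j u.1.1)).
    apply: (@measurable_fun_fubini_tonelli_F _ _ _ _ _ (iid_prob P n) f);
      last by move=> u; exact: h0.
    apply: (measurableT_comp mh); apply: measurable_cons.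
      exact: (measurableT_comp measurable_snd measurable_fst).
    exact: (measurableT_comp (measurable_set_tnth j) mswap).
  have F0 w : 0 <= F w by apply: integral_ge0.
  rewrite (@fubini_tonelli _ _ _ _ _ P P F mF F0).
  apply: eq_integral => x _.
  rewrite -[RHS](IH j (fun s => h (cons_pair (x, s))))//.
  apply: (measurableT_comp mh); apply: measurable_cons => //.
  exact: measurable_id.
have set_cons x s z : set_tnth (cons_pair (x, s)) ord0 z = cons_pair (z, s).
  apply: eq_from_tnth => k; rewrite tnth_set_tnth.
  have [l ->|->] := unliftP ord0 k; last by rewrite eqxx.
  by rewrite /cons_pair/= !tnthS.
under eq_integral do under eq_integral do
  under eq_integral do rewrite set_cons.
(* The overwritten head has disappeared from the integrand, so its integral is that of a
   constant. *)
apply: eq_integral => z _; rewrite integral_cst//.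
by rewrite -[RHS]mule1; congr (_ * _); exact: probability_setT.
Qed.

End resample.

(** * Averages against probability measures and the uniform index *)

Section averages.
Local Open Scope ereal_scope.

(** Total mass 1 is a hypothesis so that this also covers [M s], which is typed only as a
    measure. *)
Lemma integral_probability_cst {d} {T : measurableType d} {R : realType}
  (Q : {measure set T -> \bar R}) (c : \bar R) : Q setT = 1 -> \int[Q]_x c = c.
Proof. by move=> Q1; rewrite integral_cst// Q1 mule1. Qed.

Lemma integral_probability_affine {d} {T : measurableType d} {R : realType}
    (Q : {measure set T -> \bar R}) (c e : R) (f : T -> \bar R) :
  Q setT = 1 -> (0 <= c)%R -> (0 <= e)%R ->
  (forall x, 0 <= f x) -> measurable_fun setT f ->
  \int[Q]_x (c%:E * f x + e%:E) = c%:E * (\int[Q]_x f x) + e%:E.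
Proof.
move=> Q1 c0 e0 f0 mf; rewrite ge0_integralD//.
- by rewrite ge0_integralZl// integral_probability_cst.
- by move=> x _; rewrite mule_ge0.
- exact: measurable_funeM.
Qed.

Lemma mean_cst {R : realType} n (c : \bar R) : 0 <= c ->
  (n.+1%:R^-1)%:E * \sum_(i < n.+1) c = c.
Proof.
move=> c0; rewrite -[X in \sum_(_ < _) X]mul1e -ge0_sume_distrl// sumEFin.
by rewrite sumr_const card_ord muleA -EFinM mulVf ?mul1e// pnatr_eq0.
Qed.

Lemma integral_uniform_ord {R : realType} n (f : 'I_n.+1 -> \bar R) :
  (forall i, 0 <= f i) ->
  \int[@uniform_ord R n]_i f i = (n.+1%:R^-1)%:E * \sum_(i < n.+1) f i.
Proof.
move=> f0; rewrite ge0_integral_mscale//= ge0_integral_measure_sum//.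
congr (_ * _); apply: eq_bigr => i _.
by rewrite integral_dirac// diracT mul1e inord_val.
Qed.

End averages.

(** * Member and non-member means of a test function *)

Section membership_experiment.
Local Open Scope ereal_scope.
Context {dZ dY} {Z : measurableType dZ} {Y : measurableType dY} {R : realType}
  {n : nat}.
Variables (D : probability Z R) (M : R.-pker (n.+1.-tuple Z) ~> Y).

Local Notation P := (iid_prob D n.+1).

Definition model_mean (h : Z * Y -> \bar R) (z : Z) (s : n.+1.-tuple Z) :=
  \int[M s]_y h (z, y).

(** When [h] is the probability of the answer member, this is TPR and [nonmember_mean] is FPR. The
    constant 1 as [h] serves to compute the law of the bit. *)
Definition member_mean (h : Z * Y -> \bar R) : \bar R :=
  (n.+1%:R^-1)%:E * \sum_(i < n.+1) \int[P]_s model_mean h (tnth s i) s.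

Definition nonmember_mean (h : Z * Y -> \bar R) : \bar R :=
  \int[D]_z \int[P]_s model_mean h z s.

Variable h : Z * Y -> \bar R.
Hypothesis h0 : forall x, 0 <= h x.
Hypothesis mh : measurable_fun setT h.

Lemma model_mean_ge0 z s : 0 <= model_mean h z s.
Proof. exact: integral_ge0. Qed.

(** [M] is viewed as a kernel on pairs that ignores the record; integrating a jointly measurable
    function against a finite kernel is measurable in the parameter. *)
Lemma measurable_model_mean :
  measurable_fun setT (fun w : Z * n.+1.-tuple Z => model_mean h w.1 w.2).
Proof.
pose msnd := isMeasurableFun.Build _ _ _ _ _
  (@measurable_snd _ _ Z (n.+1.-tuple Z)).
pose get_data : {mfun (Z * n.+1.-tuple Z)%type >-> n.+1.-tuple Z} :=
  HB.pack snd msnd.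
pose l : R.-pker _ ~> _ := kernel_comp_fun M get_data.
have mg : measurable_fun setT
    (fun u : (Z * n.+1.-tuple Z) * Y => h (u.1.1, u.2)).
  apply: (measurableT_comp mh); apply/measurable_fun_pairP; split.
    exact: (measurableT_comp measurable_fst measurable_fst).
  exact: measurable_snd.
exact: (measurable_fun_integral_finite_kernel
  (fun u : (Z * n.+1.-tuple Z) * Y => h (u.1.1, u.2)) l).
Qed.

Lemma measurable_model_mean_model z : measurable_fun setT (model_mean h z).
Proof.
exact: (measurableT_comp measurable_model_mean (pair1_measurable z)).
Qed.

Lemma measurable_model_mean_tnth i :
  measurable_fun setT (fun s : n.+1.-tuple Z => model_mean h (tnth s i) s).
Proof.
have mpair : measurable_fun setT (fun s : n.+1.-tuple Z => (tnth s i, s)).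
  apply/measurable_fun_pairP; split; first exact: measurable_tnth.
  exact: measurable_id.
exact: (measurableT_comp measurable_model_mean mpair).
Qed.

Lemma measurable_integral_model_mean :
  measurable_fun setT (fun z => \int[P]_s model_mean h z s).
Proof.
apply: (@measurable_fun_fubini_tonelli_F _ _ _ _ _ P _ measurable_model_mean).
by move=> w; exact: model_mean_ge0.
Qed.

(** Tonelli integrates out the data and model first, then the index and fresh record, and finally
    the bit, whose value [b] has weight 1/2. *)
Lemma integral_setup (b : bool) :
  \int[setup_prob D M]_w (if setup_bit w == b then h (setup_view w) else 0) =
  (2^-1)%:E * (if b then nonmember_mean h else member_mean h).
Proof.
pose f (w : @mi_setup _ _ Z Y n) :=
  if setup_bit w == b then h (setup_view w) else 0.
have f0 w : 0 <= f w by rewrite /f; case: ifP.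
have mf : measurable_fun setT f.
  apply: measurable_fun_ifT => //; last first.
    apply: (measurableT_comp mh); exact: measurable_funP.
  apply: (measurableT_comp (f := fun c : bool => c == b)) => //.
  exact: (measurableT_comp measurable_fst measurable_snd).
rewrite (@fubini_tonelli2 _ _ _ _ _ _ _ f mf f0).
(* [G] is a function of the bit, index and fresh record, the data and model being integrated out. *)
pose G := fubini_G (joint P M) f.
have mG : measurable_fun setT G by exact: measurable_fun_fubini_tonelli_G.
have G0 q : 0 <= G q by exact: integral_ge0.
rewrite -/G (@fubini_tonelli1 _ _ _ _ _ _ _ G mG G0).
have GE q : G q = \int[P]_s \int[M s]_y f ((s, y), q).
  rewrite /G /fubini_G integral_joint//.
  apply: (measurableT_comp mf); exact: pair2_measurable.
have GbN q : q.1 != b -> G q = 0.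
  move=> qb; rewrite GE integral0_eq// => s _; rewrite integral0_eq// => y _.
  by rewrite /f /setup_bit/= (negbTE qb).
rewrite /fubini_F integral_bernoulli_prob; last first.
- by move=> c; exact: integral_ge0.
- by rewrite invr_ge0 ler0n/= invf_le1 ?ler1n.
have -> : unstable.onem (2^-1 : R)%R = (2^-1)%R.
  by rewrite /unstable.onem [X in (X - _)%R](splitr 1%R) mul1r addrK.
have bN : \int[@uniform_ord R n \x D]_q G (~~ b, q) = 0.
  by rewrite integral0_eq// => q _; rewrite GbN//=; case: (b).
have bE : \int[@uniform_ord R n \x D]_q G (b, q) =
    if b then nonmember_mean h else member_mean h.
  have mGb : measurable_fun setT (fun q => G (b, q)).
    apply: (measurableT_comp mG); exact: pair1_measurable.
  rewrite (@fubini_tonelli1 _ _ _ _ _ _ _ _ mGb)//.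
  rewrite /fubini_F integral_uniform_ord; last first.
    by move=> i; exact: integral_ge0.
  have GbE i z :
      G (b, (i, z)) = \int[P]_s model_mean h (if b then z else tnth s i) s.
    rewrite GE; apply: eq_integral => s _; apply: eq_integral => y _.
    by rewrite /f /setup_view /setup_challenge /setup_bit/= eqxx; case: (b).
  under eq_bigr do under eq_integral do rewrite GbE.
  case: (b) => /=.
    rewrite mean_cst//; apply: integral_ge0 => z _; apply: integral_ge0 => s _.
    exact: model_mean_ge0.
  congr (_ * _); apply: eq_bigr => i _.
  by rewrite integral_probability_cst//; exact: probability_setT.
by move: bN bE; case: (b) => /= -> ->; rewrite mule0 ?add0e ?adde0.
Qed.

Lemma member_mean_ge0 : 0 <= member_mean h.
Proof.
rewrite mule_ge0 ?lee_fin ?invr_ge0// sume_ge0// => i _.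
by apply: integral_ge0 => s _; exact: model_mean_ge0.
Qed.

Lemma nonmember_mean_ge0 : 0 <= nonmember_mean h.
Proof.
apply: integral_ge0 => z _; apply: integral_ge0 => s _; exact: model_mean_ge0.
Qed.

End membership_experiment.

(** * Monotonicity of the means in the test function *)

Section mean_monotone.
Local Open Scope ereal_scope.
Context {dZ dY} {Z : measurableType dZ} {Y : measurableType dY} {R : realType}
  {n : nat}.
Variables (D : probability Z R) (M : R.-pker (n.+1.-tuple Z) ~> Y).
Variables g h : Z * Y -> \bar R.
Hypotheses (g0 : forall x, 0 <= g x) (gh : forall x, g x <= h x).
Hypotheses (mg : measurable_fun setT g) (mh : measurable_fun setT h).

Let h0 x : 0 <= h x. Proof. exact: le_trans (gh x). Qed.

Lemma le_model_mean z s : model_mean M g z s <= model_mean M h z s.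
Proof.
apply: ge0_le_integral => //.
- by apply: (measurableT_comp mg); exact: pair1_measurable.
- by apply: (measurableT_comp mh); exact: pair1_measurable.
Qed.

(** With the constant 1 as [h], this and its non-member analogue bound TPR and FPR by 1. *)
Lemma le_member_mean : member_mean D M g <= member_mean D M h.
Proof.
rewrite lee_wpmul2l ?lee_fin ?invr_ge0// lee_sum// => i _.
apply: ge0_le_integral => //; rewrite ?preimage_setT.
- by move=> s _; exact: model_mean_ge0.
- exact: measurable_model_mean_tnth.
- exact: measurable_model_mean_tnth.
- by move=> s _; exact: le_model_mean.
Qed.

Lemma le_nonmember_mean : nonmember_mean D M g <= nonmember_mean D M h.
Proof.
apply: ge0_le_integral => //.
- by move=> z _; apply: integral_ge0 => s _; exact: model_mean_ge0.
- exact: measurable_integral_model_mean.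
- exact: measurable_integral_model_mean.
move=> z _; apply: ge0_le_integral => //.
- by move=> s _; exact: model_mean_ge0.
- exact: measurable_model_mean_model.
- exact: measurable_model_mean_model.
- by move=> s _; exact: le_model_mean.
Qed.

End mean_monotone.

(** * Values of a probability kernel as probability measures *)

Section kernel_prob.
Context {d1 d2} {X : measurableType d1} {Y : measurableType d2} {R : realType}.
Variables (k : R.-pker X ~> Y) (x : X).

(** A name for [k x] that can carry the probability structure expected by [integral_le_measure]. *)
Definition kernel_prob : set Y -> \bar R := k x.

HB.instance Definition _ := Measure.on kernel_prob.

HB.instance Definition _ :=
  Measure_isProbability.Build _ _ _ kernel_prob (prob_kernel x).

End kernel_prob.

(** * Comparison of TPR with FPR, and their values in the experiment *)

Section advantage.
Local Open Scope ereal_scope.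
Context {dZ dY} {Z : measurableType dZ} {Y : measurableType dY} {R : realType}
  {n : nat}.
Variables (D : probability Z R) (M : R.-pker (n.+1.-tuple Z) ~> Y).

Local Notation P := (iid_prob D n.+1).

Lemma member_mean1 : member_mean D M (cst 1) = 1.
Proof.
rewrite /member_mean -[RHS](@mean_cst _ n 1)//; congr (_ * _).
apply: eq_bigr => i _; rewrite -[RHS](@integral_probability_cst _ _ _ P).
  apply: eq_integral => s _; rewrite /model_mean integral_probability_cst//.
  exact: prob_kernel.
exact: probability_setT.
Qed.

Lemma nonmember_mean1 : nonmember_mean D M (cst 1) = 1.
Proof.
rewrite /nonmember_mean -[RHS](@integral_probability_cst _ _ _ D); last first.
  exact: probability_setT.
apply: eq_integral => z _; rewrite -[RHS](@integral_probability_cst _ _ _ P).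
  apply: eq_integral => s _; rewrite /model_mean integral_probability_cst//.
  exact: prob_kernel.
exact: probability_setT.
Qed.

(** Privacy is applied to the test function [h (z, _)]. Equal datasets are allowed because
    resampling may change nothing; there 1 <= e^eps and delta >= 0 suffice. *)
Lemma model_mean_dp (eps delta : R) (h : Z * Y -> R) z s s' :
  (0 <= eps)%R -> (0 <= delta)%R -> differentially_private eps delta M ->
  measurable_fun setT h -> (forall x, 0 <= h x <= 1)%R ->
  s = s' \/ neighbors s s' ->
  model_mean M (EFin \o h) z s <=
  (expR eps)%:E * model_mean M (EFin \o h) z s' + delta%:E.
Proof.
move=> eps0 delta0 dp mh h01 ss'.
apply: (@integral_le_measure _ _ _ (kernel_prob M s) (kernel_prob M s')
  _ _ (fun y => h (z, y))) => //.
- move=> E mE; case: ss' => [->|ss']; last exact: dp.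
  rewrite -[leLHS]adde0 leeD ?lee_fin// -[leLHS]mul1e lee_wpmul2r//.
  by rewrite lee_fin -[leLHS]expR0 ler_expR.
- by apply: (measurableT_comp mh); exact: pair1_measurable.
Qed.

(** After resampling, each member term evaluates the fresh record on a dataset that contains it;
    privacy moves to the original dataset, independent of that record. *)
Lemma member_mean_dp (eps delta : R) (h : Z * Y -> R) :
  (0 <= eps)%R -> (0 <= delta)%R -> differentially_private eps delta M ->
  measurable_fun setT h -> (forall x, 0 <= h x <= 1)%R ->
  member_mean D M (EFin \o h) <=
  (expR eps)%:E * nonmember_mean D M (EFin \o h) + delta%:E.
Proof.
move=> eps0 delta0 dp mh h01.
have h0 x : 0 <= (EFin \o h) x by rewrite lee_fin; case/andP: (h01 x).
have mEh : measurable_fun setT (EFin \o h) by exact/measurable_EFinP.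
have mm0 z s : 0 <= model_mean M (EFin \o h) z s by exact: model_mean_ge0.
have nm0 : 0 <= nonmember_mean D M (EFin \o h).
  exact: nonmember_mean_ge0.
have e0 : 0 <= (expR eps)%:E by rewrite lee_fin expR_ge0.
(* The right-hand side is written as a mean of n+1 equal terms, to compare index by index. *)
rewrite -[leRHS](@mean_cst _ n) ?adde_ge0 ?mule_ge0 ?lee_fin// lee_wpmul2l//.
apply: lee_sum => i _.
have mg := measurable_model_mean_tnth M h0 mEh i.
rewrite -(integral_resample D i)//.
have mm1 := measurable_model_mean_model M h0 mEh.
have mmF := measurable_integral_model_mean D M h0 mEh.
have eps_ge0 := expR_ge0 eps.
(* The factor e^eps and the term delta move under the integral, since [D] has mass 1; the same is
   done below for the sample law. *)
rewrite -(@integral_probability_affine _ _ _ D)//; last 2 first.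
- exact: probability_setT.
- by move=> z; exact: integral_ge0.
have mset : measurable_fun setT (fun w : Z * n.+1.-tuple Z =>
    model_mean M (EFin \o h) (tnth (set_tnth w.2 i w.1) i) (set_tnth w.2 i w.1)).
  exact: (measurableT_comp mg (measurable_set_tnth i)).
apply: ge0_le_integral => //.
- by move=> z _; exact: integral_ge0.
- exact: (@measurable_fun_fubini_tonelli_F _ _ _ _ _ P _ mset).
- by apply: emeasurable_funD => //; exact: measurable_funeM.
move=> z _.
rewrite -(@integral_probability_affine _ _ _ P)//; last exact: probability_setT.
apply: ge0_le_integral => //.
- exact: (measurableT_comp mset (pair1_measurable z)).
- by apply: emeasurable_funD => //; exact: measurable_funeM.
move=> s _; rewrite tnth_set_tnth eqxx.
by apply: model_mean_dp => //; exact: neighbors_set_tnth.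
Qed.

Variable A : R.-pker (Z * Y) ~> bool.

(** Given the setup, the guess lies in [V] with probability [A (setup_view w) V]; the setups with
    bit [b] are then handled by [integral_setup]. *)
Lemma mi_experimentE (b : bool) (V : set bool) :
  mi_experiment D M A ([set w | V w.2] `&` bit_is b) =
  (2^-1)%:E * (if b then nonmember_mean D M (A ^~ V) else member_mean D M (A ^~ V)).
Proof.
rewrite -integral_setup//; last exact: measurable_kernel.
apply: eq_integral => w _; rewrite /kernel_comp_fun.
case: eqVneq => wb.
  congr (A _ _); apply/seteqP; split=> [v|v Vv]; rewrite /xsection/= inE/=.
    by case.
  by split.
rewrite (_ : xsection _ _ = set0) ?measure0//.
apply/seteqP; split=> // v; rewrite /xsection/= inE/= => -[_ /eqP].
by rewrite (negbTE wb).
Qed.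

Lemma mi_experiment_bit (b : bool) :
  mi_experiment D M A (bit_is b) = (2^-1)%:E.
Proof.
(* The bit event is the case where every guess is accepted, whose test function is the constant
   1. *)
rewrite -[bit_is b]setTI -[setT]/[set w : mi_setup * bool | [set: bool] w.2].
rewrite mi_experimentE (_ : A ^~ _ = cst 1).
  by rewrite member_mean1 nonmember_mean1 if_same mule1.
by apply/funext => x /=; exact: prob_kernel.
Qed.

Lemma cond_prob_guess (b : bool) :
  cond_prob (mi_experiment D M A) (@guess_member _ _ _ _ n) (bit_is b) =
  fine (if b then nonmember_mean D M (A ^~ [set true])
        else member_mean D M (A ^~ [set true])).
Proof.
rewrite /cond_prob mi_experiment_bit (mi_experimentE b [set true]).
(* The factors 1/2 cancel; for infinite values both sides are 0 because [fine] sends infinities to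
   0. *)
case: (if b then _ else _) => [r||] /=.
- by rewrite mulrAC mulfV ?mul1r// invr_eq0 pnatr_eq0.
- by rewrite gt0_muley ?lte_fin ?invr_gt0// mul0r.
- by rewrite gt0_muleNy ?lte_fin ?invr_gt0// mul0r.
Qed.

End advantage.

(** * From the comparison of rates to the advantage bound *)

Theorem proposition2 (R : realType) (dZ dY : measure_display)
    (Z : measurableType dZ) (Y : measurableType dY)
    (eps delta : R) (n : nat) (D : probability Z R)
    (M : R.-pker (n.+1.-tuple Z) ~> Y) :
  0 <= eps -> 0 <= delta <= 1 ->
  differentially_private eps delta M ->
  forall A : R.-pker (Z * Y) ~> bool,
    mi_advantage D M A <= 1 - expR (- eps) + delta * expR (- eps).
Proof.
move=> eps0 /andP[delta0 _] dp A.
rewrite /mi_advantage /mi_tpr /mi_fpr !cond_prob_guess.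
pose h x : R := fine (A x [set true]).
have hE : A ^~ [set true] = EFin \o h.
  by apply/funext => x; rewrite /h /= fineK ?finite_kernel_measure.
have Ale1 x : (A x [set true] <= 1)%E.
  by rewrite -(prob_kernel (s := A) x) le_measure ?inE.
have h01 x : 0 <= h x <= 1.
  by rewrite -!lee_fin /h fineK ?finite_kernel_measure// measure_ge0 Ale1.
have mEh : measurable_fun setT (EFin \o h).
  by rewrite -hE; exact: measurable_kernel.
have mh : measurable_fun setT h by exact/measurable_EFinP.
have h0 x : (0 <= (EFin \o h) x)%E by rewrite lee_fin; case/andP: (h01 x).
have h1 x : ((EFin \o h) x <= cst 1%E x)%E by rewrite lee_fin; case/andP: (h01 x).
rewrite hE.
have := member_mean_dp D eps0 delta0 dp mh h01.
have := le_member_mean D M h0 h1 mEh (measurable_cst _).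
have := le_nonmember_mean D M h0 h1 mEh (measurable_cst _).
rewrite member_mean1 nonmember_mean1.
have := member_mean_ge0 D M h0; have := nonmember_mean_ge0 D M h0.
(* Both means lie in [0, 1], so only finite values remain: [t] is TPR and [f] is FPR. *)
case: (member_mean _ _ _) => [t||]//; case: (nonmember_mean _ _ _) => [f||]//.
rewrite /= -EFinM -EFinD !lee_fin => f0 t0 f1 t1 tf.
have e1 : expR (- eps) <= 1 by rewrite -expR0 ler_expR oppr_le0.
(* [t] is split with weights e^(-eps) and 1 - e^(-eps): the first part is bounded by privacy, the
   second by t <= 1, and the sum is the claim. *)
have : expR (- eps) * t <= f + delta * expR (- eps).
  rewrite [leRHS](_ : _ = expR (- eps) * (expR eps * f + delta)).
    by rewrite ler_wpM2l ?expR_ge0.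
  by rewrite mulrDr mulrA -expRD addNr expR0 mul1r [delta * _]mulrC.
have : (1 - expR (- eps)) * t <= 1 - expR (- eps).
  by rewrite ler_piMr ?subr_ge0.
lra.
Qed.
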